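(* Let $\{\lambda_k\}_{k\in\mathbb N}$ be a sequence of positive numbers, let $r=\{r_k\}\in\ell_2$ be a sequence of positive numbers, and let $\mathbb T=\{z\in\ell_2:\ |z_k|=r_k,\ k\in\mathbb N\}$. Let $\mathbf V_t$, $t\in\mathbb R$, be the flow $(\mathbf V_t z)_k=e^{i\lambda_k t}z_k$, and let $\lambda_{\mathbb T}$ be Kolmogorov's measure on $\mathbb T$. Let $\Gamma$ be a trajectory of the flow lying on $\mathbb T$. Then the measure $\lambda_{\mathbb T}$ is ergodic with respect to the flow $\{\mathbf V_t\}_{t\in\mathbb R}$ if and only if $\Gamma$ is everywhere dense in $\mathbb T$.
   Context: Here $\ell_2=\ell_2(\mathbb N,\mathbb C)$ with $z_k=q_k+ip_k$, viewed as a real Hilbert space $E$; $\mathbf V_t$ is the flow of the Hamiltonian system with Hamilton function $H(q,p)=\sum_{k}\frac{\lambda_k}{2}(p_k^2+q_k^2)$. The trajectory through $z_0$ is $\{\mathbf V_t z_0:\ t\in\mathbb R\}$. The torus $\mathbb T$ carries the topology induced by the norm of $E$ and is the countable product of the circles $C_k=\{|z_k|=r_k\}$. Kolmogorov's measure $\lambda_{\mathbb T}=\bigotimes_{k=1}^\infty\nu_k$ is the product probability measure on $\mathbb T$, where $\nu_k$ is the normalized Lebesgue (uniform) probability measure on the Borel $\sigma$-algebra $\mathcal B(C_k)$; it is defined on the product $\sigma$-algebra $\mathcal A$ generated by the cylindrical subsets of $\mathbb T$. A probability measure $\lambda$ on $(\mathbb T,\mathcal A)$ is ergodic with respect to a family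 $\mathcal V$ of measurable self-maps of $\mathbb T$ if there is no $\mathcal V$-invariant set $A\in\mathcal A$ with $\lambda(A)\in(0,1)$. *)

(* Defs.v *)
From HB Require Import structures.
From mathcomp Require Import all_boot all_order all_algebra.
From mathcomp Require Import all_classical all_reals all_analysis.
From mathcomp Require Import measurable_realfun complex.

Set Implicit Arguments.
Unset Strict Implicit.
Unset Printing Implicit Defensive.

Import Order.TTheory GRing.Theory Num.Theory.
Import numFieldNormedType.Exports.

Local Open Scope classical_set_scope.
Local Open Scope ring_scope.

(* The complex numbers as a real normed space: [Rcomplex R] is the alias of
   [R[i]] whose norm is the real-valued modulus. *)
HB.instance Definition _ (R : realType) :=
  PseudoMetric.copy (Rcomplex R) (pseudoMetric_normed (Rcomplex R)).
HB.instance Definition _ (R : realType) := isPointed.Build (Rcomplex R) 0.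
HB.instance Definition _ (R : realType) :=
  NormedZmod_PseudoMetric_eq.Build R (Rcomplex R) erefl.

Lemma Rcomplex_normrZ (R : realType) (l : R) (z : Rcomplex R) :
  `|l *: z| = `|l| * `|z|.
Proof.
case: z => a b.
rewrite -[LHS]/(Num.sqrt ((l * a) ^+ 2 + (l * b) ^+ 2)).
rewrite -[`|(a +i* b)%C : Rcomplex R|]/(Num.sqrt (a ^+ 2 + b ^+ 2)).
by rewrite !exprMn -mulrDr sqrtrM ?sqr_ge0// sqrtr_sqr.
Qed.

HB.instance Definition _ (R : realType) :=
  PseudoMetricNormedZmod_Lmodule_isNormedModule.Build R (Rcomplex R)
    (@Rcomplex_normrZ R).

Lemma Rcomplex_normrM (R : realType) (z w : Rcomplex R) :
  `|z * w : Rcomplex R| = `|z| * `|w|.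
Proof. exact: Normc.normcM. Qed.

Section square_summable.
Context {R : realType} {V : normedZmodType R}.
Implicit Types u v : nat -> V.

Definition sum_sqr u : R ^nat := series (fun k => `|u k| ^+ 2).

Definition square_summable u : Prop := cvgn (sum_sqr u).

Lemma sum_sqr_nd u : nondecreasing_seq (sum_sqr u).
Proof. by apply: nondecreasing_series => n _ _; exact: sqr_ge0. Qed.

Lemma sum_sqr_ge0 u n : 0 <= sum_sqr u n.
Proof. by apply: sumr_ge0 => k _; exact: sqr_ge0. Qed.

Lemma sqrt_sum_sqrS u n : Num.sqrt (sum_sqr u n.+1) =
  `|(Num.sqrt (sum_sqr u n) +i* `|u n|)%C : Rcomplex R|.
Proof.
rewrite -[RHS]/(Num.sqrt (Num.sqrt (sum_sqr u n) ^+ 2 + `|u n| ^+ 2)).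
by rewrite sqr_sqrtr ?sum_sqr_ge0// /sum_sqr /series/= big_nat_recr.
Qed.

Lemma minkowski_partial u v n :
  Num.sqrt (sum_sqr (u \+ v) n) <=
  Num.sqrt (sum_sqr u n) + Num.sqrt (sum_sqr v n).
Proof.
elim: n => [|n ih].
  by rewrite /sum_sqr /series/= !big_geq// sqrtr0 addr0.
rewrite !sqrt_sum_sqrS; apply: le_trans (ler_normD _ _).
rewrite -[leLHS]/(Num.sqrt (_ ^+ 2 + _ ^+ 2)) -[leRHS]/(Num.sqrt (_ ^+ 2 + _ ^+ 2)).
rewrite ler_wsqrtr// lerD// ler_sqr ?nnegrE ?addr_ge0 ?sqrtr_ge0//.
exact: ler_normD.
Qed.

Lemma square_summableP u :
  square_summable u <-> exists M, forall n, Num.sqrt (sum_sqr u n) <= M.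
Proof.
split=> [cu|[M uM]].
  exists (Num.sqrt (limn (sum_sqr u))) => n; apply: ler_wsqrtr.
  by apply: nondecreasing_cvgn_le => //; exact: sum_sqr_nd.
apply: nondecreasing_is_cvgn; first exact: sum_sqr_nd.
exists (M ^+ 2) => _ [n _ <-].
have M0 : 0 <= M := le_trans (sqrtr_ge0 _) (uM n).
by rewrite -[leLHS]sqr_sqrtr ?sum_sqr_ge0// ler_sqr ?nnegrE ?sqrtr_ge0.
Qed.

Lemma square_summableD u v :
  square_summable u -> square_summable v -> square_summable (u \+ v).
Proof.
move=> /square_summableP[M uM] /square_summableP[N vN]; apply/square_summableP.
by exists (M + N) => n; apply: le_trans (minkowski_partial _ _ _) (lerD _ _).
Qed.

End square_summable.

Lemma eq_norm_square_summable {R : realType} {V W : normedZmodType R}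
    (u : nat -> V) (v : nat -> W) : (forall k, `|u k| = `|v k|) ->
  square_summable u -> square_summable v.
Proof.
move=> uv; rewrite /square_summable (_ : sum_sqr u = sum_sqr v)//.
by congr series; apply/funext => k; rewrite uv.
Qed.

Section ell2.
Context {R : realType}.
Implicit Types z w : nat -> Rcomplex R.

Definition ell2_pred : {pred nat -> Rcomplex R} :=
  [pred z | `[< square_summable z >]].

Lemma ell2_predP z : reflect (square_summable z) (z \in ell2_pred).
Proof. exact: asboolP. Qed.

Lemma ell2_subproof : subsemimod_closed ell2_pred.
Proof.
split; [split|] => [|z w|a z].
- apply/ell2_predP/square_summableP; exists 0 => n.
  rewrite (_ : sum_sqr _ _ = 0) ?sqrtr0//.
  by rewrite /sum_sqr /series/= big1// => k _; rewrite normr0 expr0n.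
- by move=> /ell2_predP zs /ell2_predP ws; apply/ell2_predP/square_summableD.
move=> /ell2_predP zs; apply/ell2_predP; rewrite /square_summable.
rewrite (_ : sum_sqr _ = series (`|a| ^+ 2 *: (fun k => `|z k| ^+ 2))).
  exact: is_cvg_seriesZ.
by congr series; apply/funext => k; rewrite normrZ exprMn.
Qed.

HB.instance Definition _ :=
  GRing.isSubSemiModClosed.Build R (nat -> Rcomplex R) ell2_pred ell2_subproof.

End ell2.

Record ell2 (R : realType) : predArgType := Ell2 {
  ell2_fun :> nat -> Rcomplex R;
  _ : ell2_fun \in ell2_pred }.

HB.instance Definition _ (R : realType) := [isSub for @ell2_fun R].
HB.instance Definition _ (R : realType) := [Choice of ell2 R by <:].
HB.instance Definition _ (R : realType) := [SubChoice_isSubLmodule of ell2 R by <:].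

Section ell2_norm.
Context {R : realType}.
Implicit Types z w : ell2 R.

Lemma ell2_summable z : square_summable z.
Proof. by apply/ell2_predP; case: z. Qed.

Definition ell2_norm z : R := Num.sqrt (limn (sum_sqr z)).

Lemma sqrt_sum_sqr_le z n : Num.sqrt (sum_sqr z n) <= ell2_norm z.
Proof.
apply/ler_wsqrtr/nondecreasing_cvgn_le; first exact: sum_sqr_nd.
exact: ell2_summable.
Qed.

Lemma ell2_norm_le z M :
  0 <= M -> (forall n, Num.sqrt (sum_sqr z n) <= M) -> ell2_norm z <= M.
Proof.
move=> M0 zM; rewrite -(ger0_norm M0) -sqrtr_sqr; apply: ler_wsqrtr.
apply: limr_le; first exact: ell2_summable.
apply: nearW => n.
by rewrite -[leLHS]sqr_sqrtr ?sum_sqr_ge0// ler_sqr ?nnegrE ?sqrtr_ge0.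
Qed.

Lemma ell2_normD z w : ell2_norm (z + w) <= ell2_norm z + ell2_norm w.
Proof.
apply: ell2_norm_le => [|n]; first by rewrite addr_ge0// sqrtr_ge0.
apply: le_trans (minkowski_partial z w n) _.
by rewrite lerD// sqrt_sum_sqr_le.
Qed.

Lemma ell2_normZ (a : R) z : ell2_norm (a *: z) = `|a| * ell2_norm z.
Proof.
rewrite /ell2_norm (_ : sum_sqr _ = series (`|a| ^+ 2 *: (fun k => `|z k| ^+ 2))).
  rewrite lim_seriesZ; last exact: ell2_summable.
  rewrite -[_ *: _]/(`|a| ^+ 2 * _) sqrtrM ?sqr_ge0// sqrtr_sqr normr_id.
  by [].
by congr series; apply/funext => k; rewrite -[RHS]/(`|a| ^+ 2 * `|z k| ^+ 2) -exprMn -normrZ.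
Qed.

Lemma ell2_norm0_eq0 z : ell2_norm z = 0 -> z = 0.
Proof.
move=> z0; apply/val_inj/funext => k /=.
have := sqrt_sum_sqr_le z k.+1; rewrite z0 => zk.
apply/eqP; rewrite -normr_eq0 -sqrf_eq0 eq_le sqr_ge0 andbT.
have : sum_sqr z k.+1 <= 0 by rewrite leNgt -sqrtr_gt0 -leNgt.
apply: le_trans; rewrite /sum_sqr /series/= big_nat_recr//= lerDr.
exact: sum_sqr_ge0.
Qed.

End ell2_norm.

(* The real Hilbert space E, through its norm (sum_k |z_k|^2)^(1/2). *)
HB.instance Definition _ (R : realType) :=
  @Lmodule_isNormed.Build R (ell2 R) (@ell2_norm R)
    (@ell2_normD R) (@ell2_normZ R) (@ell2_norm0_eq0 R).

Section flow.
Context {R : realType} (lam : nat -> R).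
Implicit Types z : ell2 R.

Definition expi (theta : R) : Rcomplex R := (cos theta +i* sin theta)%C.

Lemma norm_expi theta : `|expi theta| = 1.
Proof.
rewrite -[LHS]/(Num.sqrt (cos theta ^+ 2 + sin theta ^+ 2)).
by rewrite cos2Dsin2 sqrtr1.
Qed.

Lemma flow_subproof (t : R) z :
  (fun k => expi (lam k * t) * z k : Rcomplex R) \in ell2_pred.
Proof.
apply/ell2_predP; apply: (@eq_norm_square_summable _ _ _ z); last exact: ell2_summable.
by move=> k; rewrite Rcomplex_normrM norm_expi mul1r.
Qed.

Definition flow (t : R) z : ell2 R := Ell2 (flow_subproof t z).

Definition is_trajectory (Gamma : set (ell2 R)) : Prop :=
  exists z0, Gamma = range (flow^~ z0).

End flow.

Lemma twopi_gt0 {R : realType} : 0 < 2 * pi :> R.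
Proof. by rewrite mulr_gt0 ?pi_gt0. Qed.

Lemma expi_continuous {R : realType} : continuous (@expi R).
Proof.
rewrite (_ : @expi R = fun x => cos x *: (1 : Rcomplex R) + sin x *: ('i%C : Rcomplex R)).
  move=> x; apply: cvgD; apply: cvgZr_tmp.
  - exact: continuous_cos.
  - exact: continuous_sin.
apply/funext => x; apply/eqP; rewrite eq_complex/=.
by rewrite !mulr1 !mulr0 addr0 add0r !eqxx.
Qed.

Lemma isometry_continuous {R : realType} {V W : normedModType R} (f : V -> W) :
  (forall x y, `|f x - f y| = `|x - y|) -> continuous f.
Proof.
move=> fxy w; apply/cvgrPdist_lt => e e0; near=> v.
by rewrite fxy; near: v; exact: cvgr_dist_lt.
Unshelve. all: by end_near. Qed.

Lemma expi_mul_continuous {R : realType} (theta : R) :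
  continuous (fun w : Rcomplex R => expi theta * w : Rcomplex R).
Proof.
apply: (@isometry_continuous R (Rcomplex R) (Rcomplex R)) => x y.
by rewrite -[X in `|X|]mulrBr Rcomplex_normrM norm_expi mul1r.
Qed.

Section torus.
Context {R : realType}.

(* Bundled because measurable types have to be inhabited, and the circles and
   the torus are inhabited only when the radii are nonnegative and square
   summable. *)
Record radii := Radii {
  radius :> nat -> R;
  radius_gt0 : forall k, 0 < radius k;
  radius_l2 : square_summable radius }.

Variable r : radii.

Definition circle (k : nat) : set (Rcomplex R) := [set w | `|w| = r k].

Definition torus : set (ell2 R) := [set z | forall k, circle k (z k)].

Definition Circle (k : nat) : Type := set_type (circle k).
Definition Torus : Type := set_type torus.

Lemma circle_param_subproof k theta :
  r k *: expi theta \in circle k.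
Proof.
by apply/mem_set; rewrite /circle/= normrZ norm_expi mulr1 gtr0_norm// radius_gt0.
Qed.

Definition circle_param k (theta : measurableTypeR R) : Circle k :=
  exist _ (r k *: expi theta) (circle_param_subproof k theta).

Lemma torus_point_subproof : (fun k => r k *: expi 0) \in @ell2_pred R.
Proof.
apply/ell2_predP; apply: (@eq_norm_square_summable R R _ r); last exact: radius_l2.
by move=> k; rewrite normrZ norm_expi mulr1.
Qed.

Lemma torus_point_torus : Ell2 torus_point_subproof \in torus.
Proof. by apply/mem_set => k; apply/set_mem/circle_param_subproof. Qed.

(* The library's topology on [set_type A] is the one induced by the ambient
   space. *)
HB.instance Definition _ k := PseudoMetric.copy (Circle k) (set_type (circle k)).
HB.instance Definition _ k := isPointed.Build (Circle k) (circle_param k 0).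
HB.instance Definition _ := PseudoMetric.copy Torus (set_type torus).
HB.instance Definition _ := isPointed.Build Torus
  (exist _ (Ell2 torus_point_subproof) torus_point_torus).

Definition coord k (z : Torus) : Circle k :=
  exist _ (val z k) (mem_set (set_mem (valP z) k)).

HB.instance Definition _ k := @isMeasurable.Build
  (sigma_display (@open (Circle k))) (Circle k) <<s @open (Circle k) >>
  (@sigma_algebra0 _ setT _) (@sigma_algebraC _ _)
  (@sigma_algebra_bigcup _ setT _).

Definition cylinder (n : nat) (B : forall k, set (Circle k)) : set Torus :=
  [set z | forall k, (k < n)%N -> B k (coord k z)].

Definition cylinders : set (set Torus) :=
  [set C | exists n (B : forall k, set (Circle k)),
    (forall k, measurable (B k)) /\ C = cylinder n B].

HB.instance Definition _ := @isMeasurable.Build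
  (sigma_display cylinders) Torus <<s cylinders >>
  (@sigma_algebra0 _ setT _) (@sigma_algebraC _ _)
  (@sigma_algebra_bigcup _ setT _).

Lemma circle_param_continuous k : continuous (circle_param k : R -> Circle k).
Proof.
apply: (@continuous_comp_initial _ _ _ (@set_val _ (circle k))) => x.
rewrite (_ : _ \o _ = fun theta => r k *: expi theta)//.
exact: (continuous_comp (@expi_continuous R x) (@scaler_continuous _ _ _ _)).
Qed.

Lemma measurable_circle_param k : measurable_fun setT (circle_param k).
Proof.
apply: (measurability (@open (Circle k))) => //; move=> _ [U oU <-]; rewrite setTI.
apply: (@open_measurable R); move/continuousP : (@circle_param_continuous k); exact.
Qed.

HB.instance Definition _ k :=
  isMeasurableFun.Build _ _ _ _ (circle_param k) (@measurable_circle_param k).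

(* The image of the uniform probability on [0, 2 pi] under
   theta |-> r_k e^(i theta). *)
Definition nu k : probability (Circle k) R :=
  distribution (uniform_prob (@twopi_gt0 R)) (circle_param k).

(* [P] is the product of the measures [nu r k]; the cylinders are stable by
   finite intersections and generate the sigma-algebra of the torus, so at most
   one [P] satisfies this. *)
Definition is_kolmogorov (P : probability Torus R) : Prop :=
  forall n (B : forall k, set (Circle k)), (forall k, measurable (B k)) ->
    P (cylinder n B) = (\prod_(k < n) nu k (B k))%E.

End torus.

Arguments radii : clear implicits.
Arguments cylinders {R} r _.

Section torus_flow.
Context {R : realType} (lam : nat -> R) (r : radii R).

Lemma torus_flow_subproof (t : R) (z : Torus r) : flow lam t (val z) \in torus r.
Proof.
apply/mem_set => k; rewrite /circle/= Rcomplex_normrM norm_expi mul1r.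
exact: (set_mem (valP z) k).
Qed.

Definition torus_flow (t : R) (z : Torus r) : Torus r :=
  exist _ (flow lam t (val z)) (torus_flow_subproof t z).

Lemma rotation_subproof (t : R) k (w : Circle r k) :
  (expi (lam k * t) * val w : Rcomplex R) \in circle r k.
Proof.
apply/mem_set; rewrite /circle/= Rcomplex_normrM norm_expi mul1r.
exact: (set_mem (valP w)).
Qed.

Let rotation t k (w : Circle r k) : Circle r k :=
  exist _ (expi (lam k * t) * val w : Rcomplex R) (rotation_subproof t w).

Let rotation_continuous t k : continuous (@rotation t k).
Proof.
apply: (@continuous_comp_initial _ _ _ (@set_val _ (circle r k))) => w.
rewrite (_ : _ \o _ =
  (fun v => expi (lam k * t) * v : Rcomplex R) \o @set_val _ (circle r k))//.
apply: continuous_comp; first exact: initial_continuous.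
exact: expi_mul_continuous.
Qed.

Let measurable_rotation t k : measurable_fun setT (@rotation t k).
Proof.
apply: (measurability (@open (Circle r k))); first by [].
move=> _ [U oU <-]; rewrite setTI; apply: sub_sigma_algebra.
by move/continuousP : (@rotation_continuous t k); apply.
Qed.

Lemma measurable_torus_flow t : measurable_fun setT (torus_flow t).
Proof.
apply: (measurability (cylinders r)); first by [].
move=> _ [_ [n [B [mB ->]] <-]]; rewrite setTI; apply: sub_sigma_algebra.
exists n, (fun k => @rotation t k @^-1` B k); split.
  by move=> k; rewrite -[X in measurable X]setTI; exact: measurable_rotation.
apply/seteqP; split => z /= zB k kn; have := zB k kn;
  by congr (B k _); exact: val_inj.
Qed.

HB.instance Definition _ t :=
  isMeasurableFun.Build _ _ _ _ (torus_flow t) (measurable_torus_flow t).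

End torus_flow.

(* When [V] is a flow, [V t @^-1` A = A] for all [t] is equivalent to
   [V t @` A = A] for all [t], and to [V t @` A `<=` A] for all [t]. *)
Definition ergodic d (T : measurableType d) (R : realType)
    (P : probability T R) (I : Type) (V : I -> {mfun T >-> T}) : Prop :=
  ~ exists A : set T,
    [/\ measurable A, forall i, V i @^-1` A = A & (0 < P A < 1)%E].

(* Main.v *)
(**
  Density implies ergodicity. Let [A] be invariant and [m B = P (A `&` B)]. The
  measure [m] is invariant under the flow, hence, the orbit being dense, under
  every rotation of the torus. Averaging over the rotations of one coordinate
  at a time (Fubini) shows that a measure with this invariance is a multiple of
  [P]; so [m = P A * P], and evaluating at [A] gives [P A = P A ^ 2].

  Ergodicity implies density. If [y] is not in the closure of the orbit of
  [z0], then finitely many coordinates keep [y] at distance at least [d] from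
  the orbit. The points which are [d / 2]-close in these coordinates to some
  point of the orbit form an invariant open set of positive measure, disjoint
  from the [d / 2]-box around [y], whose measure is positive too.
*)
Require Import Defs.
From HB Require Import structures.
From mathcomp Require Import all_boot all_order all_algebra.
From mathcomp Require Import all_classical all_reals all_analysis.
From mathcomp Require Import measurable_realfun complex ring lra.

Set Implicit Arguments.
Unset Strict Implicit.
Unset Printing Implicit Defensive.

Import Order.TTheory GRing.Theory Num.Theory.
Import numFieldNormedType.Exports.

Local Open Scope classical_set_scope.
Local Open Scope ring_scope.

Local Notation coord := Defs.coord.

(** * Rotations of the circles *)

Section expi.
Context {R : realType}.

Lemma Rcomplex_scalerAr (l : R) (z w : Rcomplex R) :
  z * (l *: w) = l *: (z * w).
Proof.
case: z w => [a b] [c d]; apply/eqP; rewrite eq_complex /=.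
by apply/andP; split; apply/eqP; ring.
Qed.

Lemma expiD (a b : R) : expi (a + b) = expi a * expi b.
Proof.
rewrite /expi cosD sinD -[RHS]/((_ - _) +i* (_ + _))%C.
by congr (_ +i* _)%C; rewrite addrC [X in X + _]mulrC.
Qed.

Lemma expi0 : expi (0 : R) = 1.
Proof. by rewrite /expi cos0 sin0. Qed.

Lemma expi_2pi : expi (2 * pi : R) = 1.
Proof. by rewrite /expi mulr_natl cos2pi sin2pi. Qed.

(** The sign of the imaginary part decides between [acos x] and [2 * pi - acos x]. The bound on the
    angle is kept because the periodic shift lemma below takes shifts within one period. *)
Lemma expi_surj (w : Rcomplex R) : `|w| = 1 ->
  exists2 a : R, 0 <= a <= 2 * pi & w = expi a.
Proof.
case: w => x y; rewrite -[`|_|]/(Num.sqrt (x ^+ 2 + y ^+ 2)) => n1.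
have xy1 : x ^+ 2 + y ^+ 2 = 1.
  by rewrite -[LHS]sqr_sqrtr ?addr_ge0 ?sqr_ge0// n1 expr1n.
have x1 : -1 <= x <= 1.
  rewrite -ler_norml -(@ler_pXn2r _ 2)// ?nnegrE// expr1n -normrX ger0_norm ?sqr_ge0//.
  by rewrite -xy1 lerDl sqr_ge0.
have cosa : cos (acos x) = x by apply: acosK; rewrite in_itv.
have sina : sin (acos x) = `|y|.
  by rewrite sin_acos// -xy1 addrAC subrr add0r sqrtr_sqr.
have a0 := acos_ge0 x1; have api := acos_lepi x1; have p0 := pi_gt0 R.
have [y0|y0] := leP 0 y.
  exists (acos x); first by apply/andP; split => //; lra.
  by rewrite /expi cosa sina ger0_norm.
exists (- acos x + 2 * pi); first by apply/andP; split; lra.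
rewrite expiD expi_2pi mulr1 /expi cosN sinN cosa sina ltr0_norm//.
by rewrite opprK.
Qed.

End expi.

Section circle_rotation.
Context {R : realType} (r : radii R) (k : nat).
Implicit Types (w : Circle r k) (a b : R).

Lemma rotate_subproof a w : (expi a * val w : Rcomplex R) \in circle r k.
Proof. by have := rotation_subproof (fun=> a) 1 w; rewrite mulr1. Qed.

Definition rotate a w : Circle r k :=
  exist _ (expi a * val w : Rcomplex R) (rotate_subproof a w).

Lemma rotateD a b w : rotate (a + b) w = rotate a (rotate b w).
Proof. by apply: val_inj; rewrite /= expiD mulrA. Qed.

Lemma rotate0 w : rotate 0 w = w.
Proof. by apply: val_inj; rewrite /= expi0 mul1r. Qed.

Lemma rotate_param a b :
  rotate a (circle_param r k b) = circle_param r k (a + b).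
Proof. by apply: val_inj; rewrite /= expiD Rcomplex_scalerAr. Qed.

Lemma circle_param_periodic a :
  circle_param r k (a + 2 * pi) = circle_param r k a.
Proof. by apply: val_inj; rewrite /= expiD expi_2pi mulr1. Qed.

Lemma circle_param_surj w :
  exists2 a : R, 0 <= a <= 2 * pi & w = circle_param r k a.
Proof.
have r0 := radius_gt0 r k.
have wr : `|val w| = r k by exact: (set_mem (valP w)).
have [|a a2pi wa] := @expi_surj R ((r k)^-1 *: val w).
  by rewrite normrZ wr gtr0_norm ?invr_gt0// mulVf// gt_eqF.
exists a => //; apply: val_inj; rewrite /= -wa scalerA mulfV ?scale1r//.
by rewrite gt_eqF.
Qed.

Lemma rotate_trans w w' : exists a, w' = rotate a w.
Proof.
have [a _ ->] := circle_param_surj w; have [b _ ->] := circle_param_surj w'.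
by exists (b - a); rewrite rotate_param subrK.
Qed.

Lemma dist_rotate a w w' :
  `|val (rotate a w) - val (rotate a w')| = `|val w - val w'|.
Proof.
by rewrite -[X in `|X|]/(expi a * val w - expi a * val w') -mulrBr
  Rcomplex_normrM norm_expi mul1r.
Qed.

End circle_rotation.

(** * Translations of the uniform measure on an interval *)

Section uniform_shift.
Context {R : realType}.
Local Notation mu := (@lebesgue_measure R).

Lemma lebesgue_measure_shift (c : R) (A : set R) : measurable A ->
  pushforward mu ((fun x => x + c) : _ -> measurableTypeR R) A = mu A.
Proof.
move=> mA; apply/esym/lebesgue_measure_unique => //=.
  exact: measurable_funD.
move=> mf _ [[a b]] _ <-.
rewrite /pushforward (_ : _ @^-1` _ = `](a - c), (b - c)]%classic); last first.
  by apply/seteqP; split => x /=; rewrite !in_itv /= ltrBlDr lerBrDr.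
rewrite !lebesgue_measure_itv/= !lte_fin ltrD2r; case: ifP => // _.
by rewrite -!EFinB; congr EFin; lra.
Qed.

(** The endpoint [b] is a null set. The half-open interval is preferred since its translates by
    multiples of its length tile the line. *)
Lemma uniform_probE (a b : R) (ab : a < b) (U : set R) : measurable U ->
  uniform_prob ab U = ((b - a)^-1%:E * mu (U `&` `[a, b[))%E.
Proof.
move=> mU; rewrite /uniform_prob integral_uniform_pdf.
rewrite (eq_integral (fun=> (b - a)^-1%:E)); last first.
  by move=> x; rewrite inE => -[_]; rewrite /= in_itv/= /uniform_pdf => ->.
rewrite integral_cst//=; last exact: measurableI.
have -> : U `&` `[a, b] = (U `&` `[a, b[) `|` (U `&` [set b]).
  rewrite -setIUr; congr (_ `&` _); apply/seteqP; split=> x /=; rewrite !in_itv/=.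
    by move=> /andP[-> /=]; rewrite le_eqVlt => /orP[/eqP|]; [right|left].
  by case=> [/andP[-> /ltW ->]|->] //; rewrite lexx ltW.
rewrite measureU0//; [exact: measurableI|exact: measurableI|].
apply: (subset_measure0 _ _ _ (lebesgue_measure_set1 b)) => //.
exact: measurableI.
Qed.

(** The shift moves the window [[0, T[] to [[c, T + c[]. Both windows contain [[c, T[], and
    periodicity carries the remaining piece [[T, T + c[] back to [[0, c[]. *)
Lemma uniform_prob_periodic_shift (T : R) (T0 : 0 < T) (U : set R) c :
  measurable U -> (forall x, U (x + T) <-> U x) -> 0 <= c <= T ->
  uniform_prob T0 [set x | U (x + c)] = uniform_prob T0 U.
Proof.
move=> mU UT /andP[c0 cT].
have mi (i : interval R) : measurable (U `&` [set` i]) by exact: measurableI.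
have mshift d (A : set R) : measurable A -> measurable [set x | A (x + d)].
  move=> mA; rewrite -[X in measurable X]setTI.
  by apply: (measurable_funD (@measurable_id _ _ _) (measurable_cst _)).
rewrite !uniform_probE//; last exact: mshift.
congr (_ * _)%E.
rewrite (_ : _ `&` _ = (fun x => x + c) @^-1` (U `&` `[c, T + c[)); last first.
  apply/seteqP; split => x /= [Ux]; rewrite !in_itv/= => ?; split => //;
    lra.
rewrite [LHS](lebesgue_measure_shift c)//.
have -> : U `&` `[c, T + c[ = (U `&` `[c, T[) `|` (U `&` `[T, T + c[).
  rewrite -setIUr; congr (_ `&` _); apply/seteqP; split=> x /=; rewrite !in_itv/=.
    by case: (ltP x T); lra.
  by case; lra.
have -> : U `&` `[0, T[ = (U `&` `[c, T[) `|` (U `&` `[0, c[).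
  rewrite -setIUr; congr (_ `&` _); apply/seteqP; split=> x /=; rewrite !in_itv/=.
    by case: (ltP x c); lra.
  by case; lra.
rewrite !measureU//; first congr (_ + _)%E.
- rewrite -[LHS](lebesgue_measure_shift T)//= /pushforward; congr lebesgue_measure.

  apply/seteqP; split => x /= [Ux]; rewrite !in_itv/= => ?; split;
    (lra || exact/UT).
- exact: mi.
- exact: mi.
- by apply/seteqP; split => x //= [[_] + [_]]; rewrite !in_itv/=; lra.
- exact: mi.
- exact: mi.
- by apply/seteqP; split => x //= [[_] + [_]]; rewrite !in_itv/=; lra.
Qed.

End uniform_shift.

(** * The uniform measure on a circle *)

Section circle_measure.
Context {R : realType} (r : radii R) (k : nat).

Lemma rotate_continuous :
  continuous (fun p : R * Circle r k => rotate p.1 p.2 : Circle r k).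
Proof.
apply: (@continuous_comp_initial _ _ _ (@set_val _ (circle r k))) => -[a w].
(* Since [expi (pi / 2)] is the imaginary unit, this is Euler's formula written with real scalars,
   so that continuity follows from the normed module structure. *)
have -> : set_val \o (fun p : R * Circle r k => rotate p.1 p.2) =
    (fun p => cos p.1 *: (val p.2) + sin p.1 *: (expi (pi / 2) * val p.2 : Rcomplex R)).
  apply/funext => -[b [v vr]] /=; rewrite !set_valE /=.
  rewrite -Rcomplex_scalerAr.
  case: v {vr} => x y; apply/eqP; rewrite eq_complex /= cos_pihalf sin_pihalf.
  by apply/andP; split; apply/eqP; ring.
have cval : {for (a, w), continuous (fun p : R * Circle r k => val p.2)}.
  apply: continuous_comp; first exact: cvg_snd.
  exact: (@initial_continuous _ _ (@set_val _ (circle r k))).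
apply: cvgD; apply: cvgZ.
- apply: (@continuous_comp _ _ _ fst cos); first exact: cvg_fst.
  exact: continuous_cos.
- exact: cval.
- apply: (@continuous_comp _ _ _ fst sin); first exact: cvg_fst.
  exact: continuous_sin.
- exact: (continuous_comp cval (@expi_mul_continuous _ _ _)).
Qed.

(** Joint measurability is what Fubini's theorem will require. Continuity alone gives open
    preimages; these are shown to be countable unions of rectangles, with rational intervals of
    angles as one side and, as the other, the interior of the set of points that such an interval
    keeps in [U]. *)
Lemma measurable_rotate : measurable_fun setT
  (fun p : measurableTypeR R * Circle r k => rotate p.1 p.2 : Circle r k).
Proof.
apply: (measurability (@open (Circle r k))) => // _ [U oU <-]; rewrite setTI.
pose W (q : rat * rat) : set (Circle r k) :=
  interior [set w | forall a : R, a \in `]ratr q.1, ratr q.2[ -> U (rotate a w)].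
rewrite (_ : _ @^-1` _ =
  \bigcup_(q : rat * rat) (`]ratr q.1, ratr q.2[%classic `*` W q)); last first.
  apply/seteqP; split=> [[a w] /= Uaw|[a w] [[q1 q2] _ [/= aq /interior_subset]]];
    last exact.
  have [[A B]/= [/nbhs_ballP[e /= e0 eA] wB] AB] :
      nbhs ((a, w) : R * Circle r k) [set p | U (rotate p.1 p.2)].
    by apply: (@rotate_continuous (a, w)); exact: open_nbhs_nbhs.
  have [q1 /itvP q1a] : exists q : rat, ratr q \in `]a - e, a[.
    by apply: rat_in_itvoo; rewrite ltrBlDr ltrDl.
  have [q2 /itvP q2a] : exists q : rat, ratr q \in `]a, a + e[.
    by apply: rat_in_itvoo; rewrite ltrDl.
  exists (q1, q2) => //; split; first by rewrite /= in_itv/= q1a q2a.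
  apply: filterS wB => v Bv b /itvP bq; apply: (AB (b, v)); split => //=.
  apply: eA; rewrite /ball/= ltr_distlC.
  by rewrite (lt_trans _ (_ : ratr q1 < b)) ?q1a ?bq//
             (lt_trans (_ : b < ratr q2)) ?q2a ?bq.
apply: countable_bigcupT_measurable => [|q]; first exact: countableP.
apply: measurableX; first exact: measurable_itv.
by apply: sub_sigma_algebra; exact: open_interior.
Qed.

(** Starting from [w] instead of the base point only shifts the angle, which a periodic set does not
    notice. This evaluates the inner integral when averaging over rotations. *)
Lemma nu_orbit (w : Circle r k) (D : set (Circle r k)) : measurable D ->
  uniform_prob (@twopi_gt0 R) [set a | D (rotate a w)] = nu r k D.
Proof.
move=> mD; have [b b2pi ->] := circle_param_surj w.
rewrite (_ : [set a | _] = [set a | D (circle_param r k (a + b))]); last first.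
  by apply/funext => a; rewrite /= rotate_param.
rewrite (@uniform_prob_periodic_shift _ _ _ (circle_param r k @^-1` D))//.
  by rewrite -[X in measurable X]setTI; exact: measurable_circle_param.
by move=> x; rewrite /= circle_param_periodic.
Qed.

Lemma nu_rotate a (D : set (Circle r k)) : measurable D ->
  nu r k [set w | D (rotate a w)] = nu r k D.
Proof.
move=> mD; rewrite -(nu_orbit (circle_param r k a) mD).
rewrite -[LHS]/(uniform_prob (@twopi_gt0 R) [set b | D (rotate a (circle_param r k b))]).
by congr uniform_prob; apply/funext => b; rewrite /= !rotate_param addrC.
Qed.

Lemma open_circle_measurable (U : set (Circle r k)) : open U -> measurable U.
Proof. exact: sub_sigma_algebra. Qed.

(** By continuity at angle 0, all small rotations keep [w] in [U], and the small positive angles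
    already form an interval of positive length inside [[0, 2 * pi[]. *)
Lemma nu_open_gt0 (U : set (Circle r k)) w : open U -> U w -> (0 < nu r k U)%E.
Proof.
move=> oU Uw; have mU := open_circle_measurable oU.
rewrite -(nu_orbit w mU); set V := [set a | _].
have [[A B]/= [/nbhs_ballP[e /= e0 eA] wB] AB] :
    nbhs ((0, w) : R * Circle r k) [set p | U (rotate p.1 p.2)].
  by apply: (@rotate_continuous (0, w)); rewrite /= rotate0; exact: open_nbhs_nbhs.
have p0 : 0 < 2 * pi :> R := twopi_gt0.
have mV : measurable V.
  by rewrite -[V]setTI; exact: (measurable_fun_pair1 w measurable_rotate).
rewrite uniform_probE// mule_gt0//; first by rewrite lte_fin invr_gt0 subr0.
set m := Num.min e (2 * pi).
have m0 : 0 < m by rewrite lt_min e0.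
apply: (@lt_le_trans _ _ (lebesgue_measure `]0%R, m[%classic)).
  by rewrite lebesgue_measure_itv/= lte_fin m0 oppr0 adde0 lte_fin.
apply: le_measure; rewrite ?inE//; first exact: measurableI.
move=> x /= /itvP xm; split.
  apply: (AB (x, w)); split => /=; last exact: nbhs_singleton.
  apply: eA; rewrite /ball/= sub0r normrN gtr0_norm ?xm//.
  by rewrite (lt_le_trans (_ : x < m)) ?xm// ge_min lexx.
by rewrite in_itv/= ltW ?xm//= (lt_le_trans (_ : x < m)) ?xm// ge_min lexx orbT.
Qed.

End circle_measure.

(** * Cylinders and rotations of the torus *)

Section cylinder_sets.
Context {R : realType} (r : radii R).

(** A generating class stable under finite intersections. Closed bases are chosen because the
    approximation of a rotation by the flow passes to the limit only for closed sets. *)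
Definition closed_cylinders : set (set (Torus r)) :=
  [set C | exists n (B : forall k, set (Circle r k)),
    (forall k, closed (B k)) /\ C = cylinder n B].

(* The condition at coordinate [k] only, phrased without a cast between
   [Circle r j] and [Circle r k]. *)
Definition only_coord k (F : set (Circle r k)) j : set (Circle r j) :=
  [set w | j = k -> forall w' : Circle r k, val w = val w' -> F w'].
Arguments only_coord {k} F j _.

Lemma only_coordE k (F : set (Circle r k)) : only_coord F k = F.
Proof.
apply/seteqP; split=> [w /(_ erefl w erefl)//|w Fw _ w' /val_inj <-//].
Qed.

Lemma only_coordT k (F : set (Circle r k)) j : j != k -> only_coord F j = setT.
Proof. by move=> /eqP jk; apply/seteqP; split=> // w _ /jk. Qed.

Lemma coord_preimageE k (F : set (Circle r k)) :
  @coord R r k @^-1` F = cylinder k.+1 (only_coord F).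
Proof.
apply/seteqP; split=> z /= Fz; last first.
  by have := Fz k (ltnSn k); rewrite only_coordE.
move=> j _; have [->|jk] := eqVneq j k; first by rewrite only_coordE.
by rewrite only_coordT.
Qed.

Lemma cylinder0 (B : forall k, set (Circle r k)) : cylinder 0 B = setT.
Proof. by apply/seteqP; split. Qed.

Lemma cylinderS n (B : forall k, set (Circle r k)) :
  cylinder n.+1 B = cylinder n B `&` @coord R r n @^-1` B n.
Proof.
apply/seteqP; split=> z /=.
  by move=> Bz; split=> [k kn|]; apply: Bz => //; exact: ltnW.
by case=> Bz Bn k; rewrite ltnS leq_eqVlt => /orP[/eqP->//|]; exact: Bz.
Qed.

Lemma cylinderI n m (B D : forall k, set (Circle r k)) :
  cylinder n B `&` cylinder m D = cylinder (maxn n m) (fun k =>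
    (if (k < n)%N then B k else setT) `&` (if (k < m)%N then D k else setT)).
Proof.
apply/seteqP; split=> z /=.
  by move=> [Bz Dz] k _; split; case: ifPn => // h; [exact: Bz|exact: Dz].
move=> BDz; split=> k kn.
  by have [] := BDz k; rewrite ?leq_max ?kn.
by have [] := BDz k; rewrite ?leq_max ?kn ?orbT.
Qed.

Lemma closed_circle_measurable k (F : set (Circle r k)) : closed F -> measurable F.
Proof.
move=> cF; rewrite -(setCK F); apply: measurableC; apply: open_circle_measurable.
exact: closed_openC.
Qed.

Lemma measurable_cylinder n (B : forall k, set (Circle r k)) :
  (forall k, measurable (B k)) -> measurable (cylinder n B).
Proof. by move=> mB; apply: sub_sigma_algebra; exists n, B. Qed.

Lemma measurable_coord k : measurable_fun setT (@coord R r k).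
Proof.
move=> _ B mB; rewrite setTI coord_preimageE; apply: measurable_cylinder => j.
have [->|jk] := eqVneq j k; first by rewrite only_coordE.
by rewrite only_coordT.
Qed.

Lemma closed_cylinders_setI : setI_closed closed_cylinders.
Proof.
move=> _ _ [n [B [cB ->]]] [m [D [cD ->]]]; rewrite cylinderI.
by eexists; eexists; split; last reflexivity; move=> k;
  apply: closedI; case: ifP => // _; exact: closedT.
Qed.

Lemma measurable_torusE : @measurable _ (Torus r) = <<s closed_cylinders >>.
Proof.
apply/seteqP; split; last first.
  apply: smallest_sub; first exact: sigma_algebra_measurable.
  by move=> _ [n [B [cB ->]]]; apply: measurable_cylinder => k;
    exact: closed_circle_measurable.
apply: smallest_sub; first exact: smallest_sigma_algebra.
move=> _ [n [B [mB ->]]].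
(* The torus under the smaller sigma-algebra: once its coordinates are measurable for it, every
   cylinder belongs to it. *)
pose T : measurableType _ := g_sigma_algebraType closed_cylinders.
have mcoord k : measurable_fun setT (@coord R r k : T -> Circle r k).
  apply: (measurability (@open (Circle r k))) => // _ [U oU <-]; rewrite setTI.
  rewrite -(setCK U) preimage_setC; apply: (@measurableC _ T).
  apply: sub_sigma_algebra; exists k.+1, (only_coord (~` U)); split; last first.
    exact: coord_preimageE.
  move=> j; have [->|jk] := eqVneq j k.
    by rewrite only_coordE; exact: open_closedC.
  by rewrite only_coordT//; exact: closedT.
elim: n => [|n ih].
  by rewrite cylinder0; exact: (@measurableT _ T).
rewrite cylinderS; apply: (@measurableI _ T) => //.
by rewrite -[X in measurable X]setTI; exact: mcoord.
Qed.

Lemma torus_measure_unique (m1 : {finite_measure set Torus r -> \bar R})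
    (m2 : {measure set Torus r -> \bar R}) :
  (forall n (B : forall k, set (Circle r k)), (forall k, closed (B k)) ->
    m1 (cylinder n B) = m2 (cylinder n B)) ->
  forall A, measurable A -> m1 A = m2 A.
Proof.
move=> m12 A; apply: (measure_unique closed_cylinders (fun=> setT)) => //.
- exact: measurable_torusE.
- exact: closed_cylinders_setI.
- move=> _; exists 0%N, (fun=> setT); split; first by move=> k; exact: closedT.
  by rewrite cylinder0.
- by rewrite bigcup_const.
- by move=> _ [n [B [cB ->]]]; exact: m12.
- by move=> _; exact/fin_num_fun_lty/fin_num_measure.
Qed.

End cylinder_sets.

Section torus_rotation.
Context {R : realType} (r : radii R).
Implicit Types (lam al : nat -> R) (z : Torus r) (t : R).

Lemma coord_flow lam t z k :
  coord k (torus_flow lam t z) = rotate (lam k * t) (coord k z).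
Proof. exact: val_inj. Qed.

Lemma torus_ext (z w : Torus r) : (forall k, coord k z = coord k w) -> z = w.
Proof.
move=> zw; apply/val_inj/val_inj/funext => k.
by have /(congr1 val) := zw k.
Qed.

(** Arbitrary rotations of the torus are thus represented as [torus_flow al 1], with [al] the
    sequence of angles. *)
Lemma torus_flowE lam t : torus_flow lam t = torus_flow (r := r) (fun k => lam k * t) 1.
Proof.
by apply/funext => z; apply: torus_ext => k; rewrite !coord_flow mulr1.
Qed.

Lemma torus_flowD lam s t z :
  torus_flow lam (s + t) z = torus_flow lam s (torus_flow lam t z).
Proof.
by apply: torus_ext => k; rewrite !coord_flow mulrDr rotateD.
Qed.

Lemma rotate_preimage_closed k a (F : set (Circle r k)) :
  closed F -> closed [set w | F (rotate a w)].
Proof.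
move=> cF; apply: (@closed_comp _ _ (rotate a) F) => // w _.
move: w; apply: (@continuous_comp_initial _ _ _ (@set_val _ (circle r k))) => w.
apply: (@continuous_comp _ _ _ set_val (fun v => expi a * v : Rcomplex R)).
  exact: initial_continuous.
exact: expi_mul_continuous.
Qed.

Lemma measurable_rotate_preimage k a (B : set (Circle r k)) :
  measurable B -> measurable [set w | B (rotate a w)].
Proof.
move=> mB; rewrite -[X in measurable X]setTI.
exact: (measurable_fun_pair2 a (@measurable_rotate R r k)).
Qed.

Lemma flow_preimage_cylinder lam t n (B : forall k, set (Circle r k)) :
  torus_flow lam t @^-1` cylinder n B =
  cylinder n (fun k => [set w | B k (rotate (lam k * t) w)]).
Proof.
by apply/seteqP; split=> z /= Bz k kn; have := Bz k kn; rewrite coord_flow.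
Qed.

(** The flow pulls a cylinder back to a cylinder with rotated bases, and each [nu r k] is rotation
    invariant; closed cylinders determine the measure. *)
Lemma kolmogorov_flow (P : probability (Torus r) R) lam t A :
  is_kolmogorov P -> measurable A -> P (torus_flow lam t @^-1` A) = P A.
Proof.
move=> kP mA.
apply/esym/(@torus_measure_unique R r P (pushforward P (torus_flow lam t))) => //.
move=> n B cB; rewrite -[RHS]/(P (torus_flow lam t @^-1` cylinder n B)).
rewrite flow_preimage_cylinder.
have mB k : measurable (B k) by exact: closed_circle_measurable.
rewrite -[LHS]/(P (cylinder n B)) kP// kP => [|k].
  by apply: eq_bigr => k _; rewrite nu_rotate.
exact: measurable_rotate_preimage.
Qed.

End torus_rotation.

(** * From a dense orbit to ergodicity *)

Section dense_orbit.
Context {R : realType} (r : radii R) (lam : nat -> R).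

Lemma trajectory_range (Gamma : set (ell2 R)) :
  is_trajectory lam Gamma -> Gamma `<=` torus r ->
  exists z : Torus r, val @^-1` Gamma = range (fun t => torus_flow lam t z).
Proof.
move=> [z0 ->] Gr.
have z0r : z0 \in torus r.
  apply/mem_set => k; have /(_ k) := Gr _ (imageP (flow lam ^~ z0) (I : setT 0)).
  by rewrite /circle/= Rcomplex_normrM norm_expi mul1r.
exists (exist _ z0 z0r); apply/seteqP; split=> w /= [t _ tw]; exists t => //.
  exact: val_inj.
by rewrite -tw.
Qed.

Lemma circle_ballE k (w w' : Circle r k) e :
  ball w e w' = (`|val w - val w'| < e) :> Prop.
Proof. by []. Qed.

Lemma dense_ball (T : pseudoMetricType R) (S : set T) (x : T) (e : R) :
  dense S -> 0 < e -> exists2 s, S s & ball x e s.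
Proof.
move=> dS e0; have [|s [bs Ss]] := dS (interior (ball x e)) _ (open_interior _).
  by exists x; exact: nbhsx_ballx.
by exists s => //; exact: interior_subset bs.
Qed.

Lemma ler_coord_dist (z w : Torus r) k :
  `|val (coord k z) - val (coord k w)| <= `|val z - val w|.
Proof.
apply: le_trans (sqrt_sum_sqr_le (val z - val w) k.+1).
rewrite -[leLHS]normr_id -sqrtr_sqr ler_wsqrtr// /sum_sqr /series/= big_nat_recr//=.
by rewrite lerDr sum_sqr_ge0.
Qed.

(** Rotations act transitively, commute and are isometries. Hence two rotations close at one point
    are equally close everywhere. *)
Lemma dist_rotate_angle k a b (w w' : Circle r k) :
  `|val (rotate a w) - val (rotate b w)| =
  `|val (rotate a w') - val (rotate b w')|.
Proof.
have [c ->] := rotate_trans w w'.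
by rewrite -!rotateD ![_ + c]addrC !rotateD dist_rotate.
Qed.

Variable z0 : Torus r.
Hypothesis dense_z0 : dense (range (fun t => torus_flow lam t z0)).
Variable m : {finite_measure set Torus r -> \bar R}.
Hypothesis m_inv : forall t A, measurable A -> m (torus_flow lam t @^-1` A) = m A.

(* A rotation [g] of the torus is a limit of [V_(t i)], so that the upper limit
   of the sets [V_(t i)^-1 C] lies in [g^-1 C] when [C] is closed. *)
Lemma le_measure_rotation al n (B : forall k, set (Circle r k)) :
  (forall k, closed (B k)) ->
  (m (cylinder n B) <= m (torus_flow al 1 @^-1` cylinder n B))%E.
Proof.
move=> cB; set C := cylinder n B.
have mC : measurable C.
  by apply: measurable_cylinder => k; exact: closed_circle_measurable.
have mV be t : measurable (torus_flow be t @^-1` C).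
  by rewrite -[X in measurable X]setTI; exact: measurable_torus_flow.
(* Density gives a time that approximates the rotation at [z0]; by rigidity the same time serves
   every [z], uniformly in the coordinate. *)
have /choice[t tP] (i : nat) : exists t, forall k (z : Torus r),
    ball (coord k (torus_flow al 1 z)) i.+1%:R^-1 (coord k (torus_flow lam t z)).
  have i0 : 0 < i.+1%:R^-1 :> R by rewrite invr_gt0.
  have [_ [t _ <-] bt] := dense_ball (torus_flow al 1 z0) dense_z0 i0.
  exists t => k z.
  rewrite circle_ballE.
  rewrite !coord_flow (dist_rotate_angle _ _ _ (coord k z0)) -!coord_flow.
  exact: le_lt_trans (ler_coord_dist _ _ _) bt.
have supC : lim_sup_set (fun i => torus_flow lam (t i) @^-1` C) `<=`
    torus_flow al 1 @^-1` C.
  move=> z zsup k kn; apply: contrapT => nBk.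
  have /nbhs_ballP[e /= e0 eB] := open_nbhs_nbhs (conj (closed_openC (cB k)) nBk).
  have [i _ /(_ i (leqnn i))/= ie] := near_infty_natSinv_lt (PosNum e0).
  have [j /= ij zj] := zsup i Logic.I.
  apply: (eB (coord k (torus_flow lam (t j) z))); last exact: zj.
  apply: le_ball (tP j k z); rewrite (le_trans _ (ltW ie))//.
  by rewrite lef_pV2 ?posrE// ler_nat.
have cvgsup : m (\bigcup_(k >= n) (torus_flow lam (t k) @^-1` C)) @[n --> \oo] -->
    m (lim_sup_set (fun i => torus_flow lam (t i) @^-1` C)).
  apply: lim_sup_set_cvg => [i|]; first exact: mV.
  rewrite -ge0_fin_numE//; apply: fin_num_measure.
  by apply: bigcup_measurable => i _; exact: mV.
(* Each tail union contains a set of measure [m C] by invariance, and finiteness of [m] lets the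
   bound pass to the decreasing limit. *)
apply: (@le_trans _ _ (m (lim_sup_set (fun i => torus_flow lam (t i) @^-1` C)))).
  apply: cvge_ge cvgsup; apply: nearW => i.
  rewrite -(m_inv (t i) mC); apply: le_measure; rewrite ?inE//.
    by apply: bigcup_measurable => j _; exact: mV.
  by move=> z Cz; exists i => /=.
apply: le_measure; rewrite ?inE//.
by apply: bigcap_measurable => // i _; apply: bigcup_measurable => j _; exact: mV.
Qed.

Lemma measure_rotation al t A : measurable A ->
  m (torus_flow al t @^-1` A) = m A.
Proof.
rewrite torus_flowE; set be := fun k => _; move=> mA.
apply/esym/(@torus_measure_unique R r m (pushforward m (torus_flow be 1))) => //.
move=> n B cB; apply/eqP; rewrite eq_le le_measure_rotation//=.
rewrite -[X in (X <= _)%E]/(m (torus_flow be 1 @^-1` cylinder n B)).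
rewrite flow_preimage_cylinder.
(* The reverse inequality is the same one for the inverse rotation, applied to the rotated
   cylinder. *)
apply: le_trans (le_measure_rotation (fun k => - be k) n _) _.
  by move=> k; exact: rotate_preimage_closed.
rewrite flow_preimage_cylinder.
set D := (X in cylinder n X); suff -> : D = B by [].
rewrite /D; apply: functional_extensionality_dep => k; apply/funext => w.
by rewrite /= -rotateD !mulr1 addrN rotate0.
Qed.

End dense_orbit.

(** * Uniqueness of the rotation invariant measure up to a factor *)

Section rotation_invariant_measure.
Context {R : realType} (r : radii R) (m : {finite_measure set Torus r -> \bar R}).
Hypothesis m_rot : forall al t A, measurable A ->
  m (torus_flow al t @^-1` A) = m A.

(* Averaging over all rotations of coordinate [n] replaces the condition on that
   coordinate by its probability. *)
Lemma rotation_invariant_cylinderS n (B : forall k, set (Circle r k)) :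
  (forall k, measurable (B k)) ->
  m (cylinder n.+1 B) = (nu r n (B n) * m (cylinder n B))%E.
Proof.
(* With the frequencies [e], the flow at time [a] rotates coordinate [n] by [a] and fixes the
   others. *)
move=> mB; pose e (k : nat) : R := (k == n)%:R.
pose U := uniform_prob (@twopi_gt0 R).
have mcoord (k : nat) : measurable (cylinder k B) by exact: measurable_cylinder.
pose S : set (measurableTypeR R * Torus r) :=
  [set p | cylinder n B p.2 /\ B n (rotate p.1 (coord n p.2))].
have mS : measurable S.
  have -> : S = (setT `*` cylinder n B) `&`
      (fun p => (p.1, coord n p.2) : measurableTypeR R * Circle r n) @^-1`
      ((fun q => rotate q.1 q.2) @^-1` B n).
    by apply/seteqP; split=> -[a z] /=; [move=> []|move=> [[]]].
  apply: measurableI; first exact: measurableX.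
  rewrite -[X in measurable X]setTI; apply: measurable_fun_pair => //.
    by apply: measurableT_comp; [exact: measurable_coord|exact: measurable_snd].
  by rewrite -[X in measurable X]setTI; exact: measurable_rotate.
have := @indic_fubini_tonelli _ _ _ _ R U m S mS.
rewrite indic_fubini_tonelli_FE// indic_fubini_tonelli_GE//.
(* At a fixed angle the section of [S] is the preimage of [cylinder n.+1 B] under that rotation, so
   the integrand is constant. *)
rewrite (eq_integral (fun=> m (cylinder n.+1 B))); last first.
  move=> a _; transitivity (m (torus_flow e a @^-1` cylinder n.+1 B)); last exact: m_rot.
  congr (m _).
  rewrite flow_preimage_cylinder cylinderS.
  apply/seteqP; split=> z; rewrite /xsection/= inE.
    move=> -[Bz Bn]; split; last by rewrite /= /e eqxx mul1r.
    by move=> k kn; rewrite /= /e (ltn_eqF kn) mul0r rotate0; exact: Bz.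
  move=> [Bz]; rewrite /= /e eqxx mul1r => Bn; split=> // k kn.
  by have := Bz k kn; rewrite /= /e (ltn_eqF kn) mul0r rotate0.
rewrite integral_cst// [X in (_ * X)%E]probability_setT mule1 => ->.
(* In the other order, the section at [z] is the set of angles sending its coordinate [n] into
   [B n], or is empty when [z] lies outside [cylinder n B]. *)
rewrite (eq_integral (fun z => (nu r n (B n)) * (\1_(cylinder n B) z)%:E))%E; last first.
  move=> z _ /=; rewrite indicE; have [Bz|nBz] := boolP (z \in cylinder n B).
    rewrite mule1; transitivity (U [set a | B n (rotate a (coord n z))]); last exact: nu_orbit.
    congr (U _).
    apply/seteqP; split=> a; rewrite /ysection/= inE /S /=; first by case.
    by split=> //; exact: set_mem.
  rewrite mule0 -[RHS](measure0 U); congr (U _).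
  apply/seteqP; split=> a //; rewrite /ysection/= inE /S /= => -[Bz].
  by move: nBz; rewrite (mem_set Bz).
rewrite ge0_integralZl//; last by exact/measurable_EFinP/measurable_indic.
by rewrite integral_indic// setIT.
Qed.

Lemma rotation_invariant_cylinder n (B : forall k, set (Circle r k)) :
  (forall k, measurable (B k)) ->
  m (cylinder n B) = ((\prod_(k < n) nu r k (B k)) * m setT)%E.
Proof.
move=> mB; elim: n => [|n ih]; first by rewrite cylinder0 big_ord0 mul1e.
rewrite rotation_invariant_cylinderS// ih big_ord_recr/=.
by rewrite muleA [X in (X * _)%E]muleC.
Qed.

Lemma rotation_invariant_kolmogorov (P : probability (Torus r) R) A :
  is_kolmogorov P -> measurable A -> m A = (P A * m setT)%E.
Proof.
move=> kP mA; have mT0 : 0 <= fine (m setT) by exact: fine_ge0.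
have fmT : (m setT \is a fin_num)%E by exact: fin_num_measure.
rewrite muleC -(fineK fmT) -[RHS]/(mscale (NngNum mT0) P A).
apply: torus_measure_unique => // n B cB.
have mB k : measurable (B k) by exact: closed_circle_measurable.
rewrite rotation_invariant_cylinder// -[RHS]/((fine (m setT))%:E * P (cylinder n B))%E.
by rewrite kP// muleC fineK.
Qed.

End rotation_invariant_measure.

Lemma dense_ergodic (R : realType) (r : radii R) (lam : nat -> R)
    (P : probability (Torus r) R) (z0 : Torus r) :
  is_kolmogorov P -> dense (range (fun t => torus_flow lam t z0)) ->
  ergodic P (fun t : R => torus_flow lam t : {mfun Torus r >-> Torus r}).
Proof.
move=> kP dz0 [A [mA VA /andP[PA0 PA1]]].
have fA : (P A < +oo)%E by exact: lt_le_trans PA1 (leey _).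
pose m : {finite_measure set Torus r -> \bar R} := mfrestr mA fA.
have m_inv t B : measurable B -> m (torus_flow lam t @^-1` B) = m B.
  move=> mB; rewrite /m /= /mfrestr /mrestr -{1}(VA t) -preimage_setI.
  by rewrite kolmogorov_flow//; exact: measurableI.
have := rotation_invariant_kolmogorov (measure_rotation dz0 m_inv) kP mA.
rewrite /m /= /mfrestr /mrestr setIid setTI => PAA.
have fPA : P A \is a fin_num by exact: fin_num_measure.
move: PA0 PA1 PAA; rewrite -(fineK fPA) -EFinM lte_fin lte_fin => p0 p1 [] pp.
by move: p1; rewrite -(gtr_pMr _ p0) -pp ltxx.
Qed.

(** * From ergodicity to a dense orbit *)

Section boxes.
Context {R : realType} (r : radii R).

(* The norm and product topologies agree on the torus because the tails of the
   square summable radii are small. *)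
Lemma torus_close (e : R) : 0 < e -> exists n, exists2 d, 0 < d &
  forall z w : Torus r,
    (forall k, (k < n)%N -> `|val (coord k z) - val (coord k w)| < d) ->
    `|val z - val w| < e.
Proof.
(* The first [n] coordinates and the tail contribute at most [eta] each, which bounds the norm by
   [e / 2]. The factor 4 below comes from [|z_k - w_k| <= 2 r_k]. *)
move=> e0; pose eta : R := (e / 2) ^+ 2 / 2.
have eta0 : 0 < eta by rewrite divr_gt0// exprn_gt0// divr_gt0.
have cr : cvgn (sum_sqr r) := @radius_l2 _ r.
have [n tail] : exists n, 4 * (limn (sum_sqr r) - sum_sqr r n) < eta.
  have eta4 : 0 < eta / 4 by rewrite divr_gt0.
  move/cvgrPdist_lt/(_ _ eta4) : (cr) => -[n _ /(_ n (leqnn n))/=].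
  rewrite ger0_norm ?subr_ge0 => [|]; last first.
    by apply: nondecreasing_cvgn_le => //; exact: sum_sqr_nd.
  by rewrite ltr_pdivlMr// mulrC; exists n.
(* Dividing by [n.+1] rather than [n] keeps [d] positive and well defined when [n] is 0. *)
exists n, (Num.sqrt (eta / n.+1%:R)) => [|z w zw].
  by rewrite sqrtr_gt0 divr_gt0.
apply: (@le_lt_trans _ _ (e / 2)); last by rewrite ltr_pdivrMr// ltr_pMr// ltr1n.
apply: ell2_norm_le => [|j]; first by rewrite divr_ge0// ltW.
rewrite -[leRHS]ger0_norm ?divr_ge0 ?(ltW e0)// -sqrtr_sqr ler_wsqrtr//.
apply: le_trans (sum_sqr_nd _ (leq_addl n j)) _.
rewrite /sum_sqr /series/= (@big_cat_nat _ _ _ n)//= ?leq_addr//.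
rewrite [leRHS](_ : _ = eta + eta); last by rewrite /eta -splitr.
apply: lerD.
  apply: (@le_trans _ _ (\sum_(0 <= k < n) eta / n.+1%:R)).
    apply: ler_sum_nat => k /andP[_ kn].
    have etan : 0 <= eta / n.+1%:R by exact/ltW/divr_gt0.
    rewrite -[leRHS]sqr_sqrtr// ler_sqr ?nnegrE ?sqrtr_ge0//.
    exact: ltW (zw k kn).
  rewrite sumr_const_nat subn0 -[leLHS]mulr_natr -mulrA ger_pMr//.
  by rewrite mulrC ler_pdivrMr// mul1r ler_nat.
apply: le_trans (ltW tail).
apply: (@le_trans _ _ (\sum_(n <= k < n + j) 4 * `|r k| ^+ 2)).
  apply: ler_sum_nat => k _.
  rewrite (_ : 4 * _ = (`|r k| + `|r k|) ^+ 2); last by ring.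
  rewrite ler_sqr ?nnegrE ?addr_ge0//; apply: le_trans (ler_normB _ _) _.
  have zr (u : Torus r) : `|val u k| = `|r k|.
    by rewrite (gtr0_norm (radius_gt0 r k)); exact: (set_mem (valP u) k).
  by rewrite lerD// zr.
rewrite -mulr_sumr ler_pM2l// lerBrDl.
apply: (@le_trans _ _ (sum_sqr r (n + j))).
  by rewrite /sum_sqr /series/= [leRHS](@big_cat_nat _ _ _ n)//= leq_addr.
by apply: nondecreasing_cvgn_le => //; exact: sum_sqr_nd.
Qed.

Definition box n (d : R) (w : Torus r) : set (Torus r) :=
  cylinder n (fun k => [set v | `|val (coord k w) - val v| < d]).

Lemma boxE n d w z : box n d w z = (forall k, (k < n)%N ->
  `|val (coord k w) - val (coord k z)| < d).
Proof. by []. Qed.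

Lemma open_circle_ball k (w : Circle r k) d :
  open [set v : Circle r k | `|val w - val v| < d].
Proof.
apply: (@open_comp _ _ set_val (ball (val w : Rcomplex R) d)).
  by move=> v _; exact: initial_continuous.
exact: ball_open.
Qed.

Lemma measurable_box n d w : measurable (box n d w).
Proof.
by apply: measurable_cylinder => k; apply: open_circle_measurable; exact: open_circle_ball.
Qed.

Lemma box_gt0 (P : probability (Torus r) R) n d w :
  is_kolmogorov P -> 0 < d -> (0 < P (box n d w))%E.
Proof.
move=> kP d0; rewrite kP; last first.
  by move=> k; apply: open_circle_measurable; exact: open_circle_ball.
apply: (big_ind (fun x => 0 < x)%E) => [|*|k _]; [by rewrite lte_fin| |].
  exact: mule_gt0.
apply: (@nu_open_gt0 _ _ _ _ (coord k w)); first exact: open_circle_ball.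
by rewrite /= subrr normr0.
Qed.

Lemma box_flow lam n d t z w :
  box n d (torus_flow lam t w) (torus_flow lam t z) <-> box n d w z.
Proof.
by rewrite !boxE; split=> zw k kn; have := zw k kn; rewrite !coord_flow dist_rotate.
Qed.

(** Finitely many open conditions, each continuous in time. It allows the union of boxes along an
    orbit to be taken over rational times only, which makes it measurable. *)
Lemma box_flow_near lam n d t z w : box n d (torus_flow lam t w) z ->
  \forall s \near t, box n d (torus_flow lam s w) z.
Proof.
rewrite /box; elim: n => [|n ih].
  by rewrite cylinder0 => _; apply: (@filterE _ (nbhs t)) => s; rewrite cylinder0.
have [b _ wb] := circle_param_surj (coord n w).
have cs : {for t, continuous (fun s : R => rotate (lam n * s) (coord n w))}.
  rewrite wb (_ : (fun s => _) = circle_param r n \o (fun s => lam n * s + b)).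
    apply: continuous_comp; last exact: circle_param_continuous.
    apply: cvgD; last exact: cvg_cst.
    by apply: cvgM; [exact: cvg_cst|exact: cvg_id].
  by apply/funext => s; rewrite rotate_param.
rewrite cylinderS => -[/ih tz tn].
have {}tn : nbhs (rotate (lam n * t) (coord n w))
    [set v | `|val (coord n z) - val v| < d].
  apply: open_nbhs_nbhs; split; first exact: open_circle_ball.
  suff: `|val (coord n z) - val (coord n (torus_flow lam t w))| < d.
    by rewrite coord_flow.
  by rewrite distrC.
apply: filterS2 tz (cs _ tn) => s sz sn; rewrite cylinderS; split=> //.
suff: `|val (coord n (torus_flow lam s w)) - val (coord n z)| < d by [].
by rewrite coord_flow distrC.
Qed.

End boxes.

Lemma ergodic_dense (R : realType) (r : radii R) (lam : nat -> R)
    (P : probability (Torus r) R) (z0 : Torus r) : is_kolmogorov P ->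
  ergodic P (fun t : R => torus_flow lam t : {mfun Torus r >-> Torus r}) ->
  dense (range (fun t => torus_flow lam t z0)).
Proof.
move=> kP erg; apply: contrapT => /denseNE[U [[y [oU Uy]] U0]].
have /nbhs_ballP[e /= e0 eU] := open_nbhs_nbhs (conj oU Uy).
have [n [d d0 close]] := torus_close r e0.
have far t : ~ forall k, (k < n)%N ->
    `|val (coord k y) - val (coord k (torus_flow lam t z0))| < d.
  move=> /close yt; suff : set0 (torus_flow lam t z0) by [].
  by rewrite -U0; split; [exact: eU|exists t].
have d20 : 0 < d / 2 by rewrite divr_gt0.
pose W := \bigcup_t box n (d / 2) (torus_flow lam t z0).
have mW : measurable W.
  have -> : W = \bigcup_(q : rat) box n (d / 2) (torus_flow lam (ratr q) z0).
    apply/seteqP; split=> z [t _ tz]; last by exists (ratr t).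
    have [x [/interior_subset/= xz [q _ qx]]] := @dense_rat R
      (interior [set s | box n (d / 2) (torus_flow lam s z0) z])
      (ex_intro _ t (box_flow_near tz)) (open_interior _).
    by exists q => //; rewrite qx.
  by apply: bigcupT_measurable_rat => q; exact: measurable_box.
apply: erg; exists W; split => //.
  move=> s; apply/seteqP; split=> z [t _ tz]; last first.
    by exists (s + t) => //; rewrite torus_flowD; exact/box_flow.
  exists (t - s) => //; apply/(box_flow lam n (d / 2) s).
  by rewrite -torus_flowD addrC subrK.
apply/andP; split.
  apply: lt_le_trans (box_gt0 n (torus_flow lam 0 z0) kP d20) _.
  by apply: le_measure; rewrite ?inE//; [exact: measurable_box|move=> z bz; exists 0].
have mB := measurable_box n (d / 2) y.
(* A common point of [W] and the box around [y] would put some orbit point within [d] of [y] in the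
   first [n] coordinates, against [far]. *)
apply: (@le_lt_trans _ _ (P (~` box n (d / 2) y))).
  apply: le_measure; rewrite ?inE//; first exact: measurableC.
  move=> z [t _ tz] yz; apply: (far t) => k kn.
  have /= zy := yz k kn; have /= zt := tz k kn.
  rewrite distrC in zt; apply: le_lt_trans (ler_distD (val (coord k z)) _ _) _.
  by rewrite (splitr d) ltrD.
rewrite probability_setC// lteBlDr ?fin_num_measure//.
rewrite -[X in (X < _)%E]adde0 lteD2lE//.
exact: box_gt0.
Qed.

Theorem theorem4 (R : realType) (lam : nat -> R) (lam_gt0 : forall k, 0 < lam k)
    (r : radii R) (P : probability (Torus r) R) (P_kolmogorov : is_kolmogorov P)
    (Gamma : set (ell2 R)) (Gamma_trajectory : is_trajectory lam Gamma)
    (Gamma_torus : Gamma `<=` torus r) :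
  ergodic P (fun t : R => torus_flow lam t : {mfun Torus r >-> Torus r}) <->
  dense (val @^-1` Gamma : set (Torus r)).
Proof.
have [z0 ->] := trajectory_range Gamma_trajectory Gamma_torus.
by split=> [/(ergodic_dense z0 P_kolmogorov)|/(dense_ergodic P_kolmogorov)].
Qed.
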